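(* Consider the kinetic equation $\frac{\partial f}{\partial t}+\boldsymbol v(\boldsymbol\xi)\cdot\nabla_{\boldsymbol x}f=Q[f]$ on $M$, an open subset of a topological vector space $V$ of real-valued functions on a manifold $\boldsymbol\Xi$, with a Riemannian metric $g$ on $M$, and with the equilibrium assumption (E) in force (equilibrium manifold $\iota:\tilde M\to M$, projection $\pi$). Suppose that the equation satisfies the non-degenerate H-theorem, with function $H$, and that $g$ satisfies the following: for each $f\in M$ there is a strictly positive Radon measure $\mu^f$ on $\boldsymbol\Xi$ such that $g|_f(h_1,h_2)=\int_{\boldsymbol\Xi}h_1h_2\,\mathrm d\mu^f$ for all $h_1,h_2\in T_fM$, and $$g(\cdot,\cdot)|_{\iota(\tilde f)}=\partial^2H(\tilde f)\quad\text{for each }\tilde f\in\tilde M.$$ Then the kinetic equation satisfies GSC on $(M,g)$.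
   Context: Setting: $T_fM=V$; the equation is the first-order equation $\partial_tf+\sum_{j=1}^dA^j\partial_{x^j}f=Q[f]$ where $A^j$ is multiplication by $v^j(\boldsymbol\xi)$ (identities involving $v^jh$ are understood for $h$ in the domain of $A^j$), $\boldsymbol v=(v^1,\dots,v^d):\boldsymbol\Xi\to\mathbb R^d$, and $Q$ is a smooth tangent vector field on $M$. A Radon measure is strictly positive if it is positive on nonempty open sets. Equilibrium set: $\tilde M:=\{f\in M:Q[f]=0\}$. Equilibrium assumption (E): $\tilde M$ is a smooth embedded submanifold of $M$, with embedding $\iota$, and there is a smooth map $\pi$ from an open subset of $M$ containing $\tilde M$ to $\tilde M$ with $\pi\circ\iota=\mathrm{id}_{\tilde M}$ and $g(h,\iota_*\tilde h)|_{\iota(\tilde f)}=\tilde g(\pi_*h,\tilde h)|_{\tilde f}$ for all $\tilde f\in\tilde M$, $h\in T_{\iota(\tilde f)}M$, $\tilde h\in T_{\tilde f}\tilde M$, where $\tilde g:=\iota^*g$. Collision invariants: $\mathbb E:=\{\mathfrak c\in V^*:\langle\mathfrak c,Q[f]\rangle=0\ \forall f\in M\}$. H-theorem: the equation satisfies the H-theorem if there is a real-valued function $H$ defined on a convex open set $U\subset V$ containing $\tilde M$, with strictly positive definite second-order Fréchet derivative $\partial^2H(f)$ for each $f\in U$, such that (H1) $\partial H(\tilde f)\in\mathbb E$ for each $\tilde f\in\tilde M$; (H2) for each $f\in U\cap M$, $S(f):=\langle\partial H(f),Q[f]\rangle\le0$, with equality if and only if $f\in\tilde M$. Non-degenerate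 H-theorem: the H-theorem holds and, for each $\tilde f\in\tilde M$ and each $h\in T_{\iota(\tilde f)}M\setminus\iota_*T_{\tilde f}\tilde M$, there is a constant $\lambda>0$ (which may depend on $\tilde f$ and $h$) such that $S(\tilde f+\kappa h)\le-\lambda|\kappa|^2$ for all sufficiently small $|\kappa|$. GSC (generalized stability condition) on $(M,g)$: (i) for each $\tilde f\in\tilde M$ and $h\in T_{\iota(\tilde f)}M$, $D_{\iota_*\pi_*h}Q|_{\iota(\tilde f)}=0$ and $\iota_*\pi_*D_hQ|_{\iota(\tilde f)}=0$; (ii) $g(A^jX,Y)=g(X,A^jY)$ for all $X,Y\in\Gamma(TM)$ and $j=1,\dots,d$; (iii) $g(D_hQ,h)|_{\iota(\tilde f)}<0$ for each $\tilde f\in\tilde M$ and each $h\in T_{\iota(\tilde f)}M$ with $h\ne0$ and $\iota_*\pi_*h=0$. Here $D$ is the Levi-Civita connection; since $Q$ vanishes on $\tilde M$, $D_hQ|_{\iota(\tilde f)}$ is simply the directional derivative of $Q$ at $\tilde f$ along $h$. *)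

(* Defs.v *)
From HB Require Import structures.
From mathcomp Require Import all_boot all_order all_algebra.
From mathcomp Require Import all_classical all_reals all_analysis.

Set Implicit Arguments.
Unset Strict Implicit.
Unset Printing Implicit Defensive.

Import Order.TTheory GRing.Theory Num.Theory.
Import numFieldNormedType.Exports.

Local Open Scope classical_set_scope.
Local Open Scope ring_scope.

(* The library equips E * F with a vector topology only for the locally convex
   [tvsType]; this alias of E * F carries it for arbitrary topological vector
   spaces. *)
Definition tvprod (R : realType) (E F : topologicalLmodType R) : Type :=
  (E * F)%type.

Section tvprod_instances.
Variables (R : realType) (E F : topologicalLmodType R).

HB.instance Definition _ := Topological.copy (tvprod E F) (E * F)%type.
HB.instance Definition _ := GRing.Lmodule.copy (tvprod E F) (E * F)%type.

Let tvprod_add_continuous :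
  continuous (fun x : tvprod E F * tvprod E F => x.1 + x.2).
Proof.
move => [/= xy1 xy2] /= U /= [] [A B] /= [nA nB] nU.
have [/= A0 [A01 A02] nA1] := @add_continuous E (xy1.1, xy2.1) _ nA.
have [/= B0 [B01 B02] nB1] := @add_continuous F (xy1.2, xy2.2) _ nB.
exists ([set xy | A0.1 xy.1 /\ B0.1 xy.2], [set xy | A0.2 xy.1 /\ B0.2 xy.2]).
  by split; [exists (A0.1, B0.1)|exists (A0.2, B0.2)].
move => [[x1 y1][x2 y2]] /= [] [] a1 b1 [] a2 b2.
by apply: nU; split; [exact: (nA1 (x1, x2))|exact: (nB1 (y1, y2))].
Qed.

Let tvprod_scale_continuous :
  continuous (fun z : R^o * tvprod E F => z.1 *: z.2).
Proof.
move => [/= r [x y]] /= U /= []/= [A B] /= [nA nB] nU.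
have [/= A0 [A01 A02] nA1] := @scale_continuous R E (r, x) _ nA.
have [/= B0 [B01 B02] nB1] := @scale_continuous R F (r, y) _ nB.
exists (A0.1 `&` B0.1, A0.2 `*` B0.2).
  by split; [exact: filterI|exists (A0.2,B0.2)].
by move=> [l [e f]] /= [] [Al Bl] [] Ae Be; apply: nU; split;
  [exact: (nA1 (l, e))|exact: (nB1 (l, f))].
Qed.

HB.instance Definition _ := PreTopologicalNmodule_isTopologicalNmodule.Build
  (tvprod E F) tvprod_add_continuous.
HB.instance Definition _ := TopologicalNmodule_isTopologicalLmodule.Build
  R (tvprod E F) tvprod_scale_continuous.

End tvprod_instances.

Section calculus.
Variable R : realType.
Implicit Types V W E F : topologicalLmodType R.

(* Directional derivative D_h f (x); junk value 0 if the limit does not exist. *)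
Definition dirder V W (f : V -> W) (x h : V) : W :=
  xget 0 [set l | t^-1 *: (f (x + t *: h) - f x) @[t --> (0 : R)^'] --> l].

(* C^n maps on an open set of an arbitrary topological vector space, in the
   sense of Bertram, Gloeckner and Neeb: f is C^(n+1) if the difference
   quotients (f (x + t v) - f x) / t extend, through t = 0, to a C^n map of
   (x, v, t). This is the usual class C^n (iterated directional derivatives
   exist and are jointly continuous) when the spaces are locally convex, and
   C^oo is the usual class of Frechet smooth maps in normed spaces. *)
Fixpoint class_C (n : nat) V W (U : set V) (f : V -> W) {struct n} : Prop :=
  (forall x, U x -> {for x, continuous f}) /\
  if n is m.+1 then
    let U1 := [set p : tvprod (tvprod V V) R^o |
                 U p.1.1 /\ U (p.1.1 + p.2 *: p.1.2)] in
    exists f1 : tvprod (tvprod V V) R^o -> W,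
      (forall p, U1 p -> p.2 *: f1 p = f (p.1.1 + p.2 *: p.1.2) - f p.1.1) /\
      class_C m U1 f1
  else True.

Definition smooth_on V W (U : set V) (f : V -> W) : Prop :=
  forall n, class_C n U f.

Definition tvs_bounded V (B : set V) : Prop :=
  forall N, nbhs 0 N ->
    exists s : R, 0 < s /\ forall t, s < t -> forall b, B b -> N (t^-1 *: b).

Definition dual V : set (V -> R^o) := [set c | linear c /\ continuous c].

(* Basic neighbourhoods of 0 for the strong topology of V* (uniform convergence
   on bounded sets), i.e. the norm topology of V* when V is normed. *)
Definition strong_dual_nbhs0 V : set_system (V -> R^o) :=
  [set A | exists (B : set V) (e : R), [/\ tvs_bounded B, 0 < e &
             A = [set c | forall b, B b -> `|c b| < e]]].

(* L is the Frechet derivative of f at x: difference quotients converge to the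
   continuous linear map L uniformly on bounded sets of directions. The topology
   of W is given by its system N0 of (basic) neighbourhoods of 0. *)
Definition is_frechet_derivative V (W : lmodType R) (N0 : set_system W)
    (f : V -> W) (x : V) (L : V -> W) : Prop :=
  [/\ linear L,
      forall A, N0 A -> nbhs 0 (L @^-1` A) &
      forall A B, N0 A -> tvs_bounded B ->
        \forall t \near (0 : R)^', forall b, B b ->
          A (t^-1 *: (f (x + t *: b) - f x) - L b)].

Record chart (T : topologicalType) E := Chart {
  ch_dom : set T;
  ch_cod : set E;
  ch_map : T -> E;
  ch_inv : E -> T }.

Definition is_chart (T : topologicalType) E (c : chart T E) : Prop :=
  [/\ open (ch_dom c) /\ open (ch_cod c),
      forall x, ch_dom c x -> ch_cod c (ch_map c x) /\
        ch_inv c (ch_map c x) = x,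
      forall y, ch_cod c y -> ch_dom c (ch_inv c y) /\
        ch_map c (ch_inv c y) = y,
      forall x, ch_dom c x -> {for x, continuous (ch_map c)} &
      forall y, ch_cod c y -> {for y, continuous (ch_inv c)}].

Definition smooth_manifold (n : nat) (T : topologicalType) : Prop :=
  [/\ hausdorff_space T, @second_countable T &
      exists A : set (chart T 'rV[R]_n),
        [/\ forall c, A c -> is_chart c,
            forall x, exists2 c, A c & ch_dom c x &
            forall c1 c2, A c1 -> A c2 ->
              smooth_on (ch_cod c1 `&` ch_inv c1 @^-1` ch_dom c2)
                        (ch_map c2 \o ch_inv c1)]].

(* A chart of the open set M of V, with values in E x F, that maps S to the
   slice E x {a}. *)
Definition slice_chart V (M S : set V) E F (c : chart V (tvprod E F)) (a : F) :
    Prop :=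
  [/\ is_chart c, ch_dom c `<=` M,
      smooth_on (ch_dom c) (ch_map c), smooth_on (ch_cod c) (ch_inv c) &
      forall x, ch_dom c x -> (S x <-> (ch_map c x).2 = a)].

Definition embedded_submanifold V (M S : set V) : Prop :=
  S `<=` M /\
  forall x, S x ->
    exists E F (c : chart V (tvprod E F)) (a : F),
      slice_chart M S c a /\ ch_dom c x.

(* iota_* T_x S as a subset of T_x M = V: the range of the differential, at x,
   of the local parametrizations y |-> (ch_inv c) (y, a) of S. *)
Definition tangent_space V (M S : set V) (x : V) : set V :=
  [set h | exists E F (c : chart V (tvprod E F)) (a : F) (k : E),
     [/\ slice_chart M S c a, ch_dom c x &
         h = dirder (ch_inv c) (ch_map c x) ((k, 0) : tvprod E F)]].

(* p : O -> S is smooth for the submanifold structure of S; p is represented by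
   iota o p : V -> V, with irrelevant values outside O. *)
Definition smooth_into V (M S O : set V) (p : V -> V) : Prop :=
  [/\ forall x, O x -> S (p x),
      forall x, O x -> {for x, continuous p} &
      forall E F (c : chart V (tvprod E F)) (a : F), slice_chart M S c a ->
        smooth_on (O `&` p @^-1` ch_dom c) (fun x => (ch_map c (p x)).1 : E)].

(* A weak metric: g f need not induce the topology of V. *)
Definition riemannian_metric V (M : set V) (g : V -> V -> V -> R^o) : Prop :=
  [/\ forall f h, M f -> linear (g f h),
      forall f h1 h2, M f -> g f h1 h2 = g f h2 h1,
      forall f h, M f -> h != 0 -> 0 < g f h h &
      smooth_on [set p : tvprod (tvprod V V) V | M p.1.1]
                (fun p => g p.1.1 p.1.2 p.2)].

End calculus.

Notation borel T := (g_sigma_algebraType (@open T)).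

Definition radon_measure (R : realType) (T : ptopologicalType)
    (mu : {measure set (borel T) -> \bar R}) : Prop :=
  [/\ forall K : set T, compact K -> (mu K < +oo)%E,
      forall A : set (borel T), measurable A ->
        mu A = ereal_inf [set mu (G : set T) | G in [set G | open G /\ A `<=` G]] &
      forall G : set T, open G ->
        mu G = ereal_sup [set mu (K : set T) | K in [set K | compact K /\ K `<=` G]]].

Definition strictly_positive (R : realType) (T : ptopologicalType)
    (mu : {measure set (borel T) -> \bar R}) : Prop :=
  forall G : set T, open G -> G !=set0 -> (0 < mu G)%E.

Section kinetic.
Variables (R : realType) (V : topologicalLmodType R).
Variables (M : set V) (Q : V -> V).

Definition equilibria : set V := [set f | M f /\ Q f = 0].

(* With iota the inclusion, iota_* pi_* h = dirder pi f h, and the metric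
   gt = iota^* g of the equilibrium manifold is the restriction of g to its
   tangent vectors. *)
Definition equilibrium_assumption (g : V -> V -> V -> R^o)
    (O : set V) (pi : V -> V) : Prop :=
  [/\ embedded_submanifold M equilibria,
      [/\ open O, O `<=` M & equilibria `<=` O],
      smooth_into M equilibria O pi,
      forall f, equilibria f -> pi f = f &
      forall f h k, equilibria f -> tangent_space M equilibria f k ->
        g f h k = g f (dirder pi f h) k].

Definition collision_invariants : set (V -> R^o) :=
  [set c | dual c /\ forall f, M f -> c (Q f) = 0].

(* Only the values of H, dH, d2H on U matter; there dH and d2H are determined
   by H. *)
Record H_theorem (U : set V) (H : V -> R^o) (dH : V -> V -> R^o)
    (d2H : V -> V -> V -> R^o) : Prop := {
  Hthm_open : open U;
  Hthm_convex : convex_set U;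
  Hthm_sub : equilibria `<=` U;
  Hthm_d1 : forall f, U f ->
    is_frechet_derivative (nbhs (0 : R^o)) H f (dH f);
  Hthm_d2 : forall f, U f ->
    is_frechet_derivative (@strong_dual_nbhs0 R V) dH f (d2H f);
  Hthm_d2_dual : forall f h, U f -> dual (d2H f h);
  Hthm_pos : forall f h, U f -> h != 0 -> 0 < d2H f h h;
  Hthm_H1 : forall f, equilibria f -> collision_invariants (dH f);
  Hthm_H2 : forall f, U f -> M f ->
    dH f (Q f) <= 0 /\ (dH f (Q f) = 0 <-> equilibria f) }.

Definition nondegenerate_H_theorem (U : set V) (H : V -> R^o)
    (dH : V -> V -> R^o) (d2H : V -> V -> V -> R^o) : Prop :=
  H_theorem U H dH d2H /\
  forall f h, equilibria f -> ~ tangent_space M equilibria f h ->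
    exists2 lambda : R, 0 < lambda &
      \forall k \near (0 : R),
        dH (f + k *: h) (Q (f + k *: h)) <= - lambda * `|k| ^+ 2.

(* V is a space of functions on Xi through ev : V -> (Xi -> R). The operator A^j
   is multiplication by v^j, with domain all h in V such that v^j h is in V:
   "A^j h = k". *)
Definition transport_op (Xi : Type) (ev : V -> Xi -> R) (d : nat)
    (v : Xi -> 'rV[R]_d) (j : 'I_d) (h k : V) : Prop :=
  forall xi, ev k xi = v xi ord0 j * ev h xi.

(* Q vanishes at equilibria, so the covariant derivative D_h Q is there the
   directional derivative. *)
Definition GSC (Xi : Type) (ev : V -> Xi -> R) (d : nat)
    (v : Xi -> 'rV[R]_d) (g : V -> V -> V -> R^o) (pi : V -> V) : Prop :=
  [/\ forall f h, equilibria f ->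
        dirder Q f (dirder pi f h) = 0 /\ dirder pi f (dirder Q f h) = 0,
      forall (X Y : V -> V) (j : 'I_d), smooth_on M X -> smooth_on M Y ->
        forall f AX AY, M f ->
          transport_op ev v j (X f) AX -> transport_op ev v j (Y f) AY ->
          g f AX (Y f) = g f (X f) AY &
      forall f h, equilibria f -> h != 0 -> dirder pi f h = 0 ->
        g f (dirder Q f h) h < 0].

End kinetic.

(* Main.v *)
Require Import Defs.
From mathcomp Require Import all_boot all_order all_algebra.
From mathcomp Require Import all_classical all_reals all_analysis.
Import Order.TTheory GRing.Theory Num.Theory.
Import numFieldNormedType.Exports.
Local Open Scope classical_set_scope.
Local Open Scope ring_scope.

(* At an equilibrium f write q(h) = d2H(f)(h, D_hQ). Since dH(f) annihilates the
   range of Q, the entropy production satisfies S(f + th) / t^2 -> q(h), so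
   q(h) <= 0 by the H-theorem and q(h) < 0 by nondegeneracy when h is not
   tangent to the equilibrium manifold; as g = d2H at f, this is (iii). If k is
   tangent then D_kQ = 0, hence q(h + sk) = q(h) + s g(k, D_hQ) <= 0 for every
   real s, which forces g(k, D_hQ) = 0: D_hQ is orthogonal to the tangent space,
   so its projection pi_* D_hQ is orthogonal to itself and vanishes. *)

(** * Limits, derivatives along curves and bounded sets in topological vector spaces *)

Section limits.
Set Implicit Arguments.
Unset Strict Implicit.
Variable R : realType.
Implicit Types V W E F : topologicalLmodType R.

Lemma cvg_scale V (T : Type) (F : set_system T) {FF : Filter F}
    (r : T -> R) (u : T -> V) (a : R) (l : V) :
  r t @[t --> F] --> a -> u t @[t --> F] --> l ->
  r t *: u t @[t --> F] --> a *: l.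
Proof.
move=> ra ul; have sc := @scale_continuous R V (a, l).
exact: (cvg_comp (fun t => (r t : R^o, u t)) _ (cvg_pair ra ul) sc).
Qed.

Lemma cvg_add V (T : Type) (F : set_system T) {FF : Filter F}
    (u w : T -> V) (l m : V) :
  u t @[t --> F] --> l -> w t @[t --> F] --> m ->
  u t + w t @[t --> F] --> l + m.
Proof.
move=> ul wm; have ac := @add_continuous V (l, m).
exact: (cvg_comp (fun t => (u t, w t)) _ (cvg_pair ul wm) ac).
Qed.

Lemma cvg_pair_tvprod E F (T : Type) (G : set_system T) {FG : Filter G}
    (u : T -> E) (w : T -> F) (l : E) (m : F) :
  u t @[t --> G] --> l -> w t @[t --> G] --> m ->
  ((u t, w t) : tvprod E F) @[t --> G] --> ((l, m) : tvprod E F).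
Proof. by move=> ul wm; exact: (cvg_pair ul wm). Qed.

(* Differentiability along all curves [x + t *: eta t] with velocity [h] at
   [t = 0], not only along the line: this is what makes the chain rule immediate
   without local convexity. *)
Definition has_derivative V W (f : V -> W) (x h : V) (l : W) : Prop :=
  forall eta : R -> V, eta t @[t --> (0 : R)^'] --> h ->
    t^-1 *: (f (x + t *: eta t) - f x) @[t --> (0 : R)^'] --> l.

Lemma cvg_curve V (eta : R -> V) (x h : V) :
  eta t @[t --> (0 : R)^'] --> h ->
  x + t *: eta t @[t --> (0 : R)^'] --> x.
Proof.
move=> eh; rewrite -[in X in _ --> X](addr0 x) -(scale0r h).
apply: cvg_add; first exact: cvg_cst.
by apply: cvg_scale => //; exact: cvg_within.
Qed.

Lemma scale_inv_diff V (t : R) (u w : V) :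
  t != 0 -> u + t *: (t^-1 *: (w - u)) = w.
Proof. by move=> t0; rewrite scalerA divff // scale1r addrC subrK. Qed.

(** The derivative is the extended quotient [f1] at parameter 0: along a curve of velocity [h] the
    difference quotient is [f1 ((x, eta t), t)], and [f1] is continuous. *)
Lemma smooth_has_derivative V W (U : set V) (f : V -> W) (x : V) :
  smooth_on U f -> nbhs x U ->
  exists df : V -> W, (forall h, has_derivative f x h (df h)) /\
    (hausdorff_space W -> linear df).
Proof.
move=> fs xU; have [_ [f1 [f1E [f1c _]]]] := fs 1%N.
have Ux : U x by exact: nbhs_singleton.
have f1_cvg (xi eta : R -> V) (r : R -> R^o) h :
    xi t @[t --> (0 : R)^'] --> x ->
    eta t @[t --> (0 : R)^'] --> h -> r t @[t --> (0 : R)^'] --> (0 : R^o) ->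
    f1 ((xi t, eta t), r t) @[t --> (0 : R)^'] --> f1 ((x, h), 0).
  move=> xix eh r0.
  have U1x : U x /\ U (x + (0 : R) *: h) by rewrite scale0r addr0.
  have c1 := f1c ((x, h), 0) U1x.
  exact: (cvg_comp _ _ (cvg_pair_tvprod (cvg_pair_tvprod xix eh) r0) c1).
have t0 : (t : R^o) @[t --> (0 : R)^'] --> (0 : R^o) by exact: cvg_within.
have cc (X : topologicalLmodType R) (c : X) : c @[_ --> (0 : R)^'] --> c.
  exact: cvg_cst.
exists (fun h => f1 ((x, h), 0)); split=> [h eta eh|hW s h k].
  apply: cvg_trans (f1_cvg _ _ _ _ (cc _ x) eh t0).
  apply: near_eq_cvg; near=> t => /=.
  rewrite -(f1E ((x, eta t), t : R^o)) /=; last first.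
    by split => //=; near: t; exact: (cvg_curve eh xU).
  rewrite scalerA mulVf ?scale1r //.
  by near: t; exact: nbhs_dnbhs_neq.
have st0 : (s * t : R^o) @[t --> (0 : R)^'] --> (0 : R^o).
  rewrite -[X in _ --> X](scaler0 _ s).
  exact: (cvg_scale (V := R^o) (cc _ s) t0).
have xk := cvg_curve (x := x) (cc _ k).
have xshk := cvg_curve (x := x) (cc _ (s *: h + k)).
have lhs := f1_cvg _ _ _ _ (cc _ x) (cc _ (s *: h + k)) t0.
have rhs := cvg_add (cvg_scale (cc _ s) (f1_cvg _ _ _ _ xk (cc _ h) st0))
  (f1_cvg _ _ _ _ (cc _ x) (cc _ k) t0).
(* Linearity: splitting the increment by [t *: (s *: h + k)] at [x + t *: k] expresses its quotient
   through two other values of [f1]. *)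
suff fE : \forall t \near (0 : R)^',
    s *: f1 ((x + t *: k, h), s * t : R^o) + f1 ((x, k), t : R^o) =
    f1 ((x, s *: h + k), t : R^o).
  apply: (@cvg_unique _ hW _ _ _ _ lhs).
  exact: cvg_trans (near_eq_cvg fE) (rhs _ _).
near=> t.
have Uxk : U (x + t *: k) by near: t; exact: (xk _ xU).
have Uxshk : U (x + t *: (s *: h + k)) by near: t; exact: (xshk _ xU).
have tn0 : t != 0 by near: t; exact: nbhs_dnbhs_neq.
have xE : x + t *: k + (s * t) *: h = x + t *: (s *: h + k).
  by rewrite scalerDr scalerA (mulrC t s) [_ *: h + _]addrC addrA.
apply: (scalerI tn0); rewrite scalerDr scalerA (mulrC t s).
rewrite (f1E ((x + t *: k, h), (s * t : R^o))) /=; last by rewrite /= xE.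
rewrite (f1E ((x, k), (t : R^o))) /= //.
rewrite (f1E ((x, s *: h + k), (t : R^o))) /= //.
by rewrite xE addrA subrK.
Unshelve. all: by end_near. Qed.

Lemma has_derivative_dirder V W (f : V -> W) (x h : V) (l : W) :
  hausdorff_space W -> has_derivative f x h l -> dirder f x h = l.
Proof.
move=> hW fl; have fl' := fl (fun=> h) (cvg_cst h (F := (0 : R)^')).
rewrite /dirder; apply: xget_unique => [|m fm]; first exact: fl'.
exact: (@cvg_unique _ hW _ _ _ _ fm (fl' _)).
Qed.

(** For [x != y], [b] of the difference stays positive near [(x, y)], whereas a point common to
    neighbourhoods of both has difference 0, where [b] vanishes. Applied to the metric, this gives
    uniqueness of limits in [V]. *)
Lemma pos_form_hausdorff V (b : V -> R^o) :
  (forall h, h != 0 -> 0 < b h) -> b 0 = 0 -> continuous b ->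
  hausdorff_space V.
Proof.
move=> b_gt0 b0 bc x y xy.
apply/eqP; apply/negPn/negP; rewrite -subr_eq0 => /b_gt0 bxy.
have sc : continuous (fun p : V * V => p.1 - p.2) by exact: sub_continuous.
have : \forall p \near (x, y), 0 < b (p.1 - p.2).
  have bs : b (p.1 - p.2) @[p --> (x, y)] --> (b (x - y) : R).
    exact: cvg_comp (sc (x, y)) (bc (x - y)).
  exact: (bs [set r | 0 < r] (lt_nbhsr bxy)).
move=> [[A B] /= [Ax By] AB].
have [z [Az Bz]] := xy A B Ax By.
by have := AB (z, z) (conj Az Bz); rewrite /= subrr b0 ltxx.
Qed.

(** A whole neighbourhood of the limit is absorbed, by continuity of scaling at [(0, l)]; the
    finitely many terms outside it are absorbed one by one. *)
Lemma cvg_seq_bounded V (u : nat -> V) (l : V) :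
  u n @[n --> \oo] --> l -> tvs_bounded (range u).
Proof.
move=> ul N N0.
have absorb (x : V) : exists2 s : R, 0 < s &
    exists2 W, nbhs x W & forall t, s < t -> forall w, W w -> N (t^-1 *: w).
  have N0x : nbhs ((0 : R) *: x) N by rewrite scale0r.
  have [[A W] /= [A0 Wx] AW] := @scale_continuous R V (0, x) N N0x.
  have [e /= e0 eA] := (nbhs_ballP (0 : R) A).1 A0.
  exists e^-1; first by rewrite invr_gt0.
  exists W => // t et w Ww; apply: (AW (t^-1, w)); split=> //=.
  apply: eA; rewrite /ball /= sub0r normrN.
  have t0 : 0 < t by apply: lt_trans et; rewrite invr_gt0.
  by rewrite gtr0_norm ?invr_gt0// -[e]invrK ltf_pV2// posrE ?invr_gt0.
have [s s0 [W Wl sW]] := absorb l.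
have [n0 _ n0W] := ul W Wl.
have [s' [s'0 s'W]] : exists s' : R, 0 < s' /\
    forall t, s' < t -> forall n, (n < n0)%N -> N (t^-1 *: u n).
  elim: n0 {n0W} => [|m [s1 [s10 s1N]]]; first by exists 1.
  have [s2 s20 [W2 W2u s2W]] := absorb (u m).
  exists (Num.max s1 s2); split; first by rewrite lt_max s10.
  move=> t; rewrite gt_max => /andP[t1 t2] n; rewrite ltnS leq_eqVlt.
  case/orP => [/eqP ->|nm]; last exact: s1N.
  by apply: s2W => //; exact: nbhs_singleton.
exists (Num.max s s'); split; first by rewrite lt_max s0.
move=> t; rewrite gt_max => /andP[ts ts'] _ [n _ <-].
have [nn0|nn0] := ltnP n n0; first exact: s'W.
by apply: sW => //; exact: n0W.
Qed.

End limits.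

(** * Tangent vectors of a submanifold and derivatives of maps along it *)

Section submanifold.
Set Implicit Arguments.
Unset Strict Implicit.
Variables (R : realType) (V : topologicalLmodType R) (M S : set V).
Hypothesis hV : hausdorff_space V.

(** The velocity [zeta t] may vary: a constant one yields curves inside [S], a varying one serves as
    the chain rule for maps into [S]. *)
Lemma slice_chart_curve E F (c : chart V (tvprod E F)) (a : F) (x : V)
    (zeta : R -> E) (k : E) :
  slice_chart M S c a -> ch_dom c x -> S x ->
  zeta t @[t --> (0 : R)^'] --> k ->
  t^-1 *: (ch_inv c (ch_map c x + t *: ((zeta t, 0) : tvprod E F)) - x)
    @[t --> (0 : R)^'] --> dirder (ch_inv c) (ch_map c x) ((k, 0) : tvprod E F).
Proof.
move=> [[[_ oc] mapK invK _ _] _ _ inv_smooth slice] xc Sx zk.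
have [xcod xK] := mapK _ xc.
have [df [dfP _]] :=
  smooth_has_derivative inv_smooth (open_nbhs_nbhs (conj oc xcod)).
rewrite (has_derivative_dirder hV (dfP _)).
have zk0 : ((zeta t, 0) : tvprod E F) @[t --> (0 : R)^'] -->
    ((k, 0) : tvprod E F).
  by apply: cvg_pair_tvprod => //; exact: cvg_cst.
by have := dfP _ _ zk0; rewrite xK.
Qed.

(** A straight line in the slice, mapped back by [ch_inv c], stays in [S]; [eta] is its difference
    quotient. *)
Lemma tangent_space_curve (x k : V) : S x -> tangent_space M S x k ->
  exists2 eta : R -> V, eta t @[t --> (0 : R)^'] --> k &
    \forall t \near (0 : R)^', S (x + t *: eta t).
Proof.
move=> Sx [E [F [c [a [k' [sc xc ->]]]]]].
have k'k' : k' @[_ --> (0 : R)^'] --> k' by exact: cvg_cst.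
have := slice_chart_curve sc xc Sx k'k'.
set eta := (fun t : R => _) => etak; exists eta => //.
have [[[od oc] mapK invK _ _] _ _ _ slice] := sc.
have [xcod _] := mapK _ xc.
have c0 : ((k', 0) : tvprod E F) @[_ --> (0 : R)^'] --> ((k', 0) : tvprod E F).
  exact: cvg_cst.
have codn := cvg_curve (x := ch_map c x) c0 (open_nbhs_nbhs (conj oc xcod)).
near=> t.
have tn0 : t != 0 by near: t; exact: nbhs_dnbhs_neq.
rewrite scale_inv_diff //.
set y := ch_map c x + _.
have [dG mG] : ch_dom c (ch_inv c y) /\ ch_map c (ch_inv c y) = y.
  by apply: invK; rewrite /y; near: t; exact: codn.
apply/(slice _ dG); rewrite mG /= scaler0 addr0.
by apply/(slice _ xc).
Unshelve. all: by end_near. Qed.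

(** Along a curve in [S] of velocity [k] the two difference quotients coincide. This serves to
    compare [Q] with 0 and the projection with the identity. *)
Lemma has_derivative_tangent (W : topologicalLmodType R) (f g : V -> W)
    (x k : V) (l m : W) :
  hausdorff_space W -> S x -> tangent_space M S x k ->
  has_derivative f x k l -> has_derivative g x k m -> {in S, f =1 g} -> l = m.
Proof.
move=> hW Sx /(tangent_space_curve Sx)[eta etak Seta] fl gm fg.
have fE : \forall t \near (0 : R)^',
    t^-1 *: (g (x + t *: eta t) - g x) = t^-1 *: (f (x + t *: eta t) - f x).
  by near=> t; rewrite !fg ?inE //; near: t; exact: Seta.
apply: (@cvg_unique _ hW _ _ _ _ (fl _ etak)).
exact: cvg_trans (near_eq_cvg fE) (gm _ etak).
Unshelve. all: by end_near. Qed.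

(** In a slice chart the second coordinate of [p] is the constant [a], so its smooth first
    coordinate determines [p]; composing with [ch_inv c] gives a derivative of the form that defines
    tangent vectors. *)
Lemma projection_has_derivative (O : set V) (p : V -> V) (x h : V) :
  embedded_submanifold M S -> open O -> smooth_into M S O p ->
  O x -> S x -> p x = x ->
  exists2 l, tangent_space M S x l & has_derivative p x h l.
Proof.
move=> [_ Schart] oO [pS pc psmooth] Ox Sx px.
have [E [F [c [a [sc xc]]]]] := Schart x Sx.
have [[[od oc] mapK invK _ _] _ _ _ slice] := sc.
have xO' : nbhs x (O `&` p @^-1` ch_dom c).
  apply: filterI; first exact: open_nbhs_nbhs.
  by apply: (pc x Ox); rewrite px; exact: open_nbhs_nbhs.
have [df [dfP _]] := smooth_has_derivative (psmooth E F c a sc) xO'.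
exists (dirder (ch_inv c) (ch_map c x) ((df h, 0) : tvprod E F)).
  by exists E, F, c, a, (df h).
move=> eta etah.
apply: cvg_trans (slice_chart_curve sc xc Sx (dfP _ _ etah)).
apply: near_eq_cvg; near=> t.
have tn0 : t != 0 by near: t; exact: nbhs_dnbhs_neq.
have [Ox' dpx'] : O (x + t *: eta t) /\ ch_dom c (p (x + t *: eta t)).
  by near: t; exact: (cvg_curve etah xO').
rewrite px; congr (_ *: (_ - _)).
rewrite -[RHS](mapK _ dpx').2; congr (ch_inv c _).
have S2 z : ch_dom c z -> S z -> (ch_map c z).2 = a by move=> /slice[].
rewrite [RHS]surjective_pairing (S2 _ dpx' (pS _ Ox')).
rewrite [X in X + _]surjective_pairing (S2 _ xc Sx).
congr pair => /=; first by rewrite scale_inv_diff.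
by rewrite scaler0 addr0.
Unshelve. all: by end_near. Qed.
End submanifold.

Lemma harmonic_dnbhs0 (R : realType) :
  (n.+1%:R^-1 : R) @[n --> \oo] --> (0 : R)^'.
Proof.
move=> A A0; have A0' : nbhs (0 : R) [set r | r != 0 -> A r] := A0.
have hA : \forall n \near \oo, (n.+1%:R^-1 : R) != 0 -> A n.+1%:R^-1.
  exact: (cvg_harmonic A0').
have nz n : (n.+1%:R^-1 : R) != 0 by rewrite invr_eq0 pnatr_eq0.
exact: filterS (fun n => @^~ (nz n)) hA.
Qed.

(** * Second-order behaviour of the entropy production at an equilibrium *)

Section entropy.
Set Implicit Arguments.
Unset Strict Implicit.
Variables (R : realType) (V : topologicalLmodType R) (M U : set V) (Q : V -> V).
Variables (H : V -> R^o) (dH : V -> V -> R^o) (d2H : V -> V -> V -> R^o).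
Hypothesis HT : H_theorem M Q U H dH d2H.
Hypothesis M_open : open M.

Lemma equilibrium_near f h : equilibria M Q f ->
  \forall t \near (0 : R)^', M (f + t *: h) /\ U (f + t *: h).
Proof.
move=> Ef; have hc : h @[_ --> (0 : R)^'] --> h by exact: cvg_cst.
have Uf := Hthm_sub HT Ef; have [Mf _] := Ef.
have MU : nbhs f (M `&` U).
  apply: filterI; apply: open_nbhs_nbhs; split=> //.
  exact: Hthm_open HT.
exact: (cvg_curve (x := f) hc MU).
Qed.

(* [dH] is differentiable only uniformly on bounded sets of vectors; taking the
   limit along a sequence makes the difference quotients of [Q] such a set. *)
Lemma entropy_production_cvg f h l :
  equilibria M Q f -> has_derivative Q f h l ->
  let t n : R := n.+1%:R^-1 in
  ((t n)^-1 ^+ 2 * dH (f + t n *: h) (Q (f + t n *: h)) : R) @[n --> \oo]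
    --> (d2H f h l : R).
Proof.
move=> Ef Ql t; have Uf := Hthm_sub HT Ef.
have t0 : t n @[n --> \oo] --> (0 : R)^' by exact: harmonic_dnbhs0.
have hc : h @[_ --> (0 : R)^'] --> h by exact: cvg_cst.
pose u n := (t n)^-1 *: (Q (f + t n *: h) - Q f).
have ul : u n @[n --> \oo] --> l by exact: cvg_comp t0 (Ql _ hc).
have dul : (d2H f h (u n) : R) @[n --> \oo] --> (d2H f h l : R).
  by have [_ c] := Hthm_d2_dual HT h Uf; exact: cvg_comp ul (c l).
apply/cvgrPdist_lt => e e0.
have e20 : 0 < e / 2 by rewrite divr_gt0.
have [_ _ fr] := Hthm_d2 HT Uf.
have bh : tvs_bounded [set h].
  have -> : [set h] = range (fun _ : nat => h).
    by apply/seteqP; split=> [_ ->|_ [n _ <-]//]; exists 0%N.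
  by apply: (@cvg_seq_bounded _ _ _ h); exact: cvg_cst.
have A0 : strong_dual_nbhs0
    [set c : V -> R^o | forall b, range u b -> `|c b| < e / 2].
  by exists (range u), (e / 2); split=> //; exact: cvg_seq_bounded ul.
have frn := t0 _ (fr _ _ A0 bh).
have dun := (cvgrPdist_lt _ _).1 dul _ e20.
near=> n.
have tn0 : t n != 0 by rewrite invr_neq0 // pnatr_eq0.
have [Mn Un] : M (f + t n *: h) /\ U (f + t n *: h).
  by near: n; exact: t0 _ (equilibrium_near h Ef).
have [dHn_lin _ _] := Hthm_d1 HT Un.
have [_ Ef0] := Ef.
have [[dHf_lin _] dHf_Q] := Hthm_H1 HT Ef.
pose quot b : V -> R^o := (t n)^-1 *: (dH (f + t n *: b) - dH f).
(* One factor [(t n)^-1] forms the quotient of [Q], the other that of [dH]: subtracting [dH f]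
   changes nothing, as it vanishes on the range of [Q]. *)
have -> : (t n)^-1 ^+ 2 * dH (f + t n *: h) (Q (f + t n *: h)) = quot h (u n).
  rewrite /u Ef0 subr0; set q := Q _.
  change ((t n)^-1 ^+ 2 * dH (f + t n *: h) q =
    (t n)^-1 * (dH (f + t n *: h) ((t n)^-1 *: q) - dH f ((t n)^-1 *: q))).
  have -> : dH f ((t n)^-1 *: q) = 0.
    by rewrite (GRing.scalable_linear dHf_lin) dHf_Q //; exact: mulr0.
  by rewrite (GRing.scalable_linear dHn_lin) subr0 expr2 -mulrA.
have dn : `|d2H f h l - d2H f h (u n)| < e / 2 by near: n; exact: dun.
have dd : `|(quot h - d2H f h) (u n)| < e / 2.
  suff qd : forall b, [set h] b -> forall b', range u b' ->
      `|(quot b - d2H f b) b'| < e / 2 by apply: qd => //; exists n.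
  by rewrite /quot; near: n; exact: frn.
rewrite distrC in dd.
rewrite [e]splitr; apply: le_lt_trans (ltrD dn dd).
apply: le_trans (ler_normD _ _).
by rewrite addrA subrK.
Unshelve. all: by end_near. Qed.

(** Divide by the square of [k] and pass to the limit. Taking [lambda] to be 0 gives the sign of the
    Hessian form, a positive [lambda] its strict negativity. *)
Lemma entropy_production_le f h l (lambda : R) :
  equilibria M Q f -> has_derivative Q f h l ->
  (\forall k \near (0 : R)^',
    dH (f + k *: h) (Q (f + k *: h)) <= - lambda * `|k| ^+ 2) ->
  d2H f h l <= - lambda.
Proof.
move=> Ef Ql Sle.
apply: (cvgr_to_le (entropy_production_cvg Ef Ql)).
have /= Sn := @harmonic_dnbhs0 R _ Sle.
near=> n.
have t0 : 0 < (n.+1%:R^-1 : R) by rewrite invr_gt0 ltr0n.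
rewrite exprVn mulrC ler_pdivrMr ?exprn_gt0//.
rewrite -{3}(gtr0_norm t0).
by near: n; exact: Sn.
Unshelve. all: by end_near. Qed.

Lemma entropy_hessian_le0 f h l :
  equilibria M Q f -> has_derivative Q f h l -> d2H f h l <= 0.
Proof.
move=> Ef Ql; rewrite -oppr0; apply: (entropy_production_le Ef Ql).
near=> t; rewrite oppr0 mul0r.
have [Mt Ut] : M (f + t *: h) /\ U (f + t *: h).
  by near: t; exact: equilibrium_near Ef.
by have [] := Hthm_H2 HT Ut Mt.
Unshelve. all: by end_near. Qed.

Lemma affine_le0 (a b : R) : (forall s, s * a + b <= 0) -> a = 0.
Proof.
move=> ab; apply/eqP/negPn/negP => a0.
(* This [s] makes the affine expression equal to 1. *)
have := ab ((1 - b) / a); rewrite mulfVK // subrK.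
by rewrite ler10.
Qed.

(** Adding [s *: k] to [h] does not change its image under [dQ], so the Hessian form is affine in
    [s] with the claimed quantity as slope; it is nonpositive for all [s], hence the slope is 0. *)
Lemma entropy_hessian_tangent f h k (dQ : V -> V) :
  equilibria M Q f -> (forall h, has_derivative Q f h (dQ h)) -> linear dQ ->
  dQ k = 0 -> d2H f k (dQ h) = 0.
Proof.
move=> Ef dQP dQl dQk0; have Uf := Hthm_sub HT Ef.
apply: (@affine_le0 _ (d2H f h (dQ h))) => s.
have := entropy_hessian_le0 Ef (dQP (s *: k + h)).
have [d2l _ _] := Hthm_d2 HT Uf.
by rewrite d2l dQl dQk0 scaler0 add0r.
Qed.
End entropy.

Theorem theorem9 (R : realType) (n d : nat)
    (Xi : ptopologicalType) (v : Xi -> 'rV[R]_d)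
    (V : topologicalLmodType R) (ev : {linear V -> (Xi -> R^o)})
    (M : set V) (Q : V -> V) (g : V -> V -> V -> R^o)
    (O : set V) (pi : V -> V)
    (U : set V) (H : V -> R^o) (dH : V -> V -> R^o) (d2H : V -> V -> V -> R^o)
    (Xi_manifold : smooth_manifold R n Xi)
    (ev_inj : injective ev)
    (M_open : open M)
    (Q_smooth : smooth_on M Q)
    (g_metric : riemannian_metric M g)
    (E_assumption : equilibrium_assumption M Q g O pi)
    (H_thm : nondegenerate_H_theorem M Q U H dH d2H)
    (g_L2 : forall f, M f ->
      exists mu : {measure set (borel Xi) -> \bar R},
        [/\ radon_measure mu, strictly_positive mu &
            forall h1 h2 : V,
              mu.-integrable setT (fun xi => (ev h1 xi * ev h2 xi)%:E) /\
              ((g f h1 h2)%:E = \int[mu]_xi (ev h1 xi * ev h2 xi)%:E)%E])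
    (g_d2H : forall f, equilibria M Q f ->
      forall h1 h2 : V, g f h1 h2 = d2H f h1 h2) :
  GSC M Q ev v g pi.
Proof.
have [g_lin g_sym g_pos g_smooth] := g_metric.
have [Esub [openO subOM subEO] pi_smooth pi_id g_pi] := E_assumption.
have [HT nondeg] := H_thm.
(* A point of [M] carries a continuous positive definite form, so [V] is Hausdorff and [dirder] is
   the unique limit. *)
have V_hausdorff f : M f -> hausdorff_space V.
  move=> Mf; apply: (@pos_form_hausdorff _ _ (fun h => g f h h)).
  - by move=> h; exact: g_pos.
  - have := GRing.scalable_linear (g_lin f 0 Mf) 0 0.
    by rewrite scale0r => ->; exact: mul0r.
  - move=> h.
    have gc := (g_smooth 0%N).1 ((f, h), h) Mf.
    have hh : h' @[h' --> h] --> h by [].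
    have ff : f @[_ --> h] --> f by exact: cvg_cst.
    exact: (cvg_comp _ _ (cvg_pair_tvprod (cvg_pair_tvprod ff hh) hh) gc).
have dQ_ex f : M f -> exists dQ : V -> V,
    (forall h, has_derivative Q f h (dQ h)) /\ linear dQ.
  move=> Mf; have hV := V_hausdorff f Mf.
  have [dQ [dQP dQl]] :=
    smooth_has_derivative Q_smooth (open_nbhs_nbhs (conj M_open Mf)).
  by exists dQ; split=> //; exact: dQl.
have pi_ex f h : equilibria M Q f ->
    exists2 l, tangent_space M (equilibria M Q) f l & has_derivative pi f h l.
  move=> Ef; have [Mf _] := Ef.
  have hV := V_hausdorff f Mf.
  apply: (projection_has_derivative hV h Esub openO pi_smooth) => //.
    exact: subEO.
  exact: pi_id.
have dQ_tangent f k l : equilibria M Q f ->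
    tangent_space M (equilibria M Q) f k -> has_derivative Q f k l -> l = 0.
  move=> Ef kT Ql; have [Mf _] := Ef; have hV := V_hausdorff f Mf.
  apply: (has_derivative_tangent hV hV Ef kT Ql (g := fun=> 0)); last first.
    by move=> x; rewrite inE => -[].
  by move=> eta _; under eq_fun do rewrite subrr scaler0; exact: cvg_cst.
have pi_tangent f k : equilibria M Q f ->
    tangent_space M (equilibria M Q) f k -> dirder pi f k = k.
  move=> Ef kT; have [Mf _] := Ef; have hV := V_hausdorff f Mf.
  have [l _ pl] := pi_ex f k Ef; rewrite (has_derivative_dirder hV pl).
  apply: (has_derivative_tangent hV hV Ef kT pl (g := id)); last first.
    by move=> x; rewrite inE => /pi_id.
  move=> eta etak; apply: cvg_trans etak; apply: near_eq_cvg; near=> t.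
  rewrite addrAC subrr add0r scalerA mulVf ?scale1r //.
  by near: t; exact: nbhs_dnbhs_neq.
split.
- move=> f h Ef; have [Mf _] := Ef; have hV := V_hausdorff f Mf.
  have [dQ [dQP dQl]] := dQ_ex f Mf.
  have [l lT pl] := pi_ex f h Ef.
  rewrite (has_derivative_dirder hV pl) !(has_derivative_dirder hV (dQP _)).
  split; first exact: dQ_tangent Ef lT (dQP l).
  have [m mT pm] := pi_ex f (dQ h) Ef.
  rewrite (has_derivative_dirder hV pm).
  (* Here [m] is the projection of [dQ h], so [g f m m = g f (dQ h) m = d2H f m (dQ h)], which is 0
     because [m] is tangent. *)
  apply/eqP/negPn/negP => /(g_pos f m Mf).
  rewrite -{1}(has_derivative_dirder hV pm) -g_pi // g_sym // g_d2H //.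
  rewrite (entropy_hessian_tangent HT M_open h Ef dQP dQl) ?ltxx //.
  exact: dQ_tangent Ef mT (dQP m).
(* The factor [v xi ord0 j] moves from one function to the other under the integral. *)
- move=> X Y j _ _ f AX AY Mf AXE AYE.
  have [mu [_ _ gE]] := g_L2 f Mf.
  apply: EFin_inj; rewrite !(gE _ _).2.
  by apply: eq_integral => xi _; rewrite AXE AYE (mulrC (v xi ord0 j)) -mulrA.
- move=> f h Ef h0 pih0; have [Mf _] := Ef; have hV := V_hausdorff f Mf.
  have [dQ [dQP dQl]] := dQ_ex f Mf.
  rewrite (has_derivative_dirder hV (dQP _)) g_sym // g_d2H //.
  (* The projection fixes tangent vectors, so a nonzero [h] with zero projection is not tangent and
     nondegeneracy applies. *)
  have hT : ~ tangent_space M (equilibria M Q) f h.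
    by move=> /(pi_tangent _ _ Ef); rewrite pih0 => h0'; rewrite h0' eqxx in h0.
  have [lambda l0 lS] := nondeg f h Ef hT.
  have := entropy_production_le HT M_open Ef (dQP h) (nbhs_dnbhs lS).
  by move=> /le_lt_trans; apply; rewrite oppr_lt0.
Unshelve. all: by end_near. Qed.
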